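(* Let $\alpha_1,\alpha_2\in\mathbb R$ be linearly independent over $\mathbb Q$. Let $\Gamma=(\mathbb R\times\{0\})\cup(\{0\}\times\mathbb R)\subset\mathbb R^2$ and $\Lambda=L_{\alpha_1}\cup L_{\alpha_2}$, where $L_{\alpha_j}=\{(\xi,\eta)\in\mathbb R^2:\eta-\xi=\alpha_j\}$ for $j=1,2$. Then $(\Gamma,\Lambda)$ is a $\mathcal C$-HUP; that is, if $\mu\in\mathcal C$ satisfies $\hat\mu(\xi,\eta)=0$ for all $(\xi,\eta)\in\Lambda$, then $\mu=0$.
   Context: For a finite complex Borel measure $\mu$ on $\mathbb R^2$, the Fourier transform is $\hat\mu(\xi,\eta)=\int e^{-i\pi(x\xi+y\eta)}\,d\mu(x,y)$, $(\xi,\eta)\in\mathbb R^2$. For $\Gamma=(\mathbb R\times\{0\})\cup(\{0\}\times\mathbb R)$, $\mathcal C$ denotes the set of all finite complex Borel measures $\mu$ on $\mathbb R^2$ of the form $d\mu(x,y)=f(x)\,dx\,d\delta_0(y)-f(y)\,d\delta_0(x)\,dy$ for some $f\in L^1(\mathbb R)$, where $\delta_0$ is the point mass at $0$. The pair $(\Gamma,\Lambda)$ is called a $\mathcal C$-HUP if the only $\mu\in\mathcal C$ with $\hat\mu|_\Lambda=0$ is $\mu=0$. *)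

(* Defs.v *)
From HB Require Import structures.
From mathcomp Require Import all_boot all_order all_algebra.
From mathcomp Require Import all_classical all_reals all_analysis.
From mathcomp Require Import measurable_realfun complex.

Set Implicit Arguments.
Unset Strict Implicit.
Unset Printing Implicit Defensive.
Import Order.TTheory GRing.Theory Num.Theory.
Import numFieldNormedType.Exports.

Local Open Scope classical_set_scope.
Local Open Scope ring_scope.
Local Open Scope complex_scope.

(* A finite complex measure, given by its real and imaginary parts; the type
   {charge set T -> \bar R} consists of the finite signed measures. *)
Record complex_measure d (T : measurableType d) (R : realType) :=
  ComplexMeasure {
    cm_re : {charge set T -> \bar R} ;
    cm_im : {charge set T -> \bar R} }.

Definition cm_val d (T : measurableType d) (R : realType)
    (mu : complex_measure T R) (A : set T) : R[i] :=
  fine (cm_re mu A) +i* fine (cm_im mu A).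

Coercion cm_val : complex_measure >-> Funclass.

Section integrals.
Context d (T : measurableType d) (R : realType).

Definition cintegrable (m : {measure set T -> \bar R}) (f : T -> R[i]) :=
  m.-integrable setT (EFin \o (fun x => complex.Re (f x))) /\
  m.-integrable setT (EFin \o (fun x => complex.Im (f x))).

Definition cintegral (m : {measure set T -> \bar R}) (A : set T)
    (f : T -> R[i]) : R[i] :=
  (\int[m]_(x in A) complex.Re (f x)) +i* (\int[m]_(x in A) complex.Im (f x)).

Definition hahn_pos (nu : {charge set T -> \bar R}) : set T :=
  projT1 (cid (Hahn_decomposition nu)).

Definition hahn_neg (nu : {charge set T -> \bar R}) : set T :=
  projT1 (cid (projT2 (cid (Hahn_decomposition nu)))).

Lemma hahn_posneg (nu : {charge set T -> \bar R}) :
  hahn_decomposition nu (hahn_pos nu) (hahn_neg nu).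
Proof. exact: (projT2 (cid (projT2 (cid (Hahn_decomposition nu))))). Qed.

(* Integration against a signed measure, through its Jordan decomposition. *)
Definition charge_integral (nu : {charge set T -> \bar R}) (g : T -> R) : R :=
  \int[jordan_pos (hahn_posneg nu)]_x g x
  - \int[jordan_neg (hahn_posneg nu)]_x g x.

(* (g1 + i g2)(dnu1 + i dnu2) expanded into real and imaginary parts. *)
Definition cm_integral (mu : complex_measure T R) (g : T -> R[i]) : R[i] :=
  let re x := complex.Re (g x) in
  let im x := complex.Im (g x) in
  (charge_integral (cm_re mu) re - charge_integral (cm_im mu) im) +i*
  (charge_integral (cm_im mu) re + charge_integral (cm_re mu) im).

End integrals.

(* exp (i t) *)
Definition expi (R : realType) (t : R) : R[i] := cos t +i* sin t.

Section plane.
Variable R : realType.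
Local Notation rR := (measurableTypeR R).
Local Notation plane := (rR * rR)%type.
Local Notation leb := (@lebesgue_measure R).
Local Notation delta0 := (dirac (0 : rR) : {measure set rR -> \bar R}).

Definition fourier (mu : complex_measure plane R) (p : R * R) : R[i] :=
  cm_integral mu (fun z => expi (- (pi * (z.1 * p.1 + z.2 * p.2)))).

Definition cross : set (R * R) := [set z | z.2 = 0] `|` [set z | z.1 = 0].

(* dmu(x,y) = f(x) dx ddelta_0(y) - f(y) ddelta_0(x) dy, where the complex
   L^1 function f is represented by a Borel function. *)
Definition classC : set (complex_measure plane R) :=
  [set mu | exists2 f : rR -> R[i], cintegrable leb f &
    forall A : set plane, measurable A ->
      mu A = cintegral (leb \x delta0)%E A (fun z => f z.1)
           - cintegral (delta0 \x leb)%E A (fun z => f z.2)].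

(* The members of classC live on the cross, so that the first component of the
   pair (cross, Lambda) in the definition of a HUP is implicit in the class. *)
Lemma classC_cross (mu : complex_measure plane R) (A : set plane) :
  classC mu -> measurable A -> A `&` cross = set0 -> mu A = 0.
Proof.
move=> [f [fre fim] muE] mA Across; rewrite (muE _ mA).
have Hx (x : rR) : xsection A x (0 : rR) -> False.
  rewrite xsectionE => Ax.
  suff : (A `&` cross) (x, 0) by rewrite Across.
  by split=> //; left.
have Hy (y : rR) : xsection A (0 : rR) y -> False.
  rewrite xsectionE => Ay.
  suff : (A `&` cross) (0, y) by rewrite Across.
  by split=> //; right.
have N1 : (leb \x delta0)%E A = 0%E.
  rewrite /product_measure1; apply: integral0_eq => x _ /=.
  by rewrite diracE memNset// => /Hx.
have N2 : (delta0 \x leb)%E A = 0%E.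
  rewrite /product_measure1 integral_dirac//=.
    by rewrite diracT mul1e (_ : xsection _ _ = set0) ?measure0//;
      apply/seteqP; split => // y /Hy.
  exact: measurable_fun_xsection.
have cont (g : rR -> R[i]) (m : {measure set plane -> \bar R}) (p : plane -> rR) :
    measurable_fun setT p -> cintegrable leb g -> m A = 0%E ->
    cintegral m A (fun z => g (p z)) = 0.
  move=> mp [/measurable_int gr /measurable_int gi] mA0.
  have Z (h : plane -> \bar R) : measurable_fun setT h ->
      fine (\int[m]_(x in A) h x)%E = 0.
    by move=> mh; rewrite null_set_integral//; exact: measurable_funTS.
  rewrite /cintegral /Rintegral; congr (_ +i* _); apply: Z.
  - exact: (measurableT_comp gr mp).
  - exact: (measurableT_comp gi mp).
have fi : cintegrable leb f by [].
have c1 := cont f _ _ measurable_fst fi N1.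
have c2 := cont f _ _ measurable_snd fi N2.
by rewrite c1 c2 subrr.
Qed.

Definition is_HUP (C : set (complex_measure plane R)) (Lambda : set (R * R)) :=
  forall mu, C mu -> (forall p, Lambda p -> fourier mu p = 0) ->
    forall A : set plane, measurable A -> mu A = 0.

Definition line (alpha : R) : set (R * R) := [set p | p.2 - p.1 = alpha].

Definition rat_independent (a b : R) :=
  forall p q : rat, ratr p * a + ratr q * b = 0 -> p = 0 /\ q = 0.

End plane.

(* Main.v *)
(* On the line eta = xi + alpha the transform of the measure given by f is
   F(xi) - F(xi + alpha), where F is the Fourier transform of f; its vanishing
   says that f(x) (1 - e^{-i pi alpha x}) has zero Fourier transform, hence is
   zero almost everywhere.  As 1 - e^{-i pi alpha x} vanishes only on a
   countable set when alpha <> 0, f is zero almost everywhere.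

   Uniqueness of the Fourier transform is obtained from a multiplier algebra.
   The bounded functions u such that L(u g) = 0 for all g with L(g e) = 0 for
   all trigonometric e form an algebra closed under bounded pointwise limits.
   It contains sin (h (x - a)), hence, by polynomial approximation of the sign,
   sgn (sin (h (x - a))), hence, as h -> 0, sgn (x - a), hence the indicators of
   the Borel sets. *)
Require Import Defs.
From mathcomp Require Import all_boot all_order all_algebra.
From mathcomp Require Import all_classical all_reals all_analysis.
From mathcomp Require Import measurable_realfun complex.
From mathcomp Require Import finmap ring lra.

Set Implicit Arguments.
Unset Strict Implicit.
Unset Printing Implicit Defensive.
Import Order.TTheory GRing.Theory Num.Theory.
Import numFieldNormedType.Exports.

Local Open Scope classical_set_scope.
Local Open Scope ring_scope.

(** * Functionals continuous under bounded pointwise convergence *)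

Section bounded_measurable.
Context d (T : measurableType d) (R : realType).
Implicit Types (f g h : T -> R) (V : set (T -> R)) (L : (T -> R) -> R).

Definition bmeas : set (T -> R) :=
  [set g : T -> R | measurable_fun setT g /\ exists M, forall x, `|g x| <= M].

Lemma bmeasD g h : bmeas g -> bmeas h -> bmeas (fun x => g x + h x).
Proof.
move=> [mg [M gM]] [mh [N hN]]; split; first exact: measurable_funD.
by exists (M + N) => x; rewrite (le_trans (ler_normD _ _))// lerD.
Qed.

Lemma bmeasM g h : bmeas g -> bmeas h -> bmeas (fun x => g x * h x).
Proof.
move=> [mg [M gM]] [mh [N hN]]; split; first exact: measurable_funM.
by exists (M * N) => x; rewrite normrM ler_pM.
Qed.

Lemma bmeas_cst (a : R) : bmeas (fun=> a).
Proof. by split; [exact: measurable_cst|exists `|a|]. Qed.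

Lemma bmeas_indic A : measurable A -> bmeas \1_A.
Proof.
move=> mA; split; first exact: measurable_indic.
by exists 1 => x; rewrite indicE; case: (_ \in _); rewrite ?normr1 ?normr0.
Qed.

Lemma bmeas_lim (u : nat -> T -> R) g M :
  (forall n, measurable_fun setT (u n)) -> (forall n x, `|u n x| <= M) ->
  (forall x, u ^~ x @ \oo --> g x) -> bmeas g.
Proof.
move=> mu uM ug; split.
  by apply: (measurable_fun_cvg (h := u)) => // x _; exact: ug.
exists M => x.
have /(cvg_lim (@Rhausdorff R)) <- : `|u n x| @[n --> \oo] --> `|g x|.
  exact: cvg_norm (ug x).
apply: limr_le; last by near=> n; exact: uM.
by apply/cvg_ex; exists `|g x|; exact: cvg_norm (ug x).
Unshelve. all: by end_near. Qed.

(** The bound [M], uniform in [n], is what dominated convergence asks for on a finite measure;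
    kernels of integration are therefore closed in this sense. *)
Record bclosed V := BClosed {
  bclosed_sub : V `<=` bmeas ;
  bclosedD : forall g h, V g -> V h -> V (fun x => g x + h x) ;
  bclosedZ : forall a g, V g -> V (fun x => a * g x) ;
  bclosed_lim : forall (u : nat -> T -> R) g M, (forall n, V (u n)) ->
    (forall n x, `|u n x| <= M) -> (forall x, u ^~ x @ \oo --> g x) -> V g }.

Lemma bclosed_sum V (I : Type) (r : seq I) (F : I -> T -> R) : bclosed V ->
  (forall i, V (F i)) -> V (fun=> 0) -> V (fun x => \sum_(i <- r) F i x).
Proof.
move=> cV VF V0; elim: r => [|i r IH].
  by under eq_fun do rewrite big_nil.
by under eq_fun do rewrite big_cons; exact: bclosedD.
Qed.

Import HBNNSimple.

(** A functional monotone class argument: simple functions are finite combinations of indicators,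
    and a nonnegative bounded function is a pointwise limit of simple functions lying below it. *)
Lemma bclosed_bmeas V : bclosed V -> (forall A, measurable A -> V \1_A) ->
  bmeas `<=` V.
Proof.
move=> cV V1.
have V0 : V (fun=> 0).
  by have := V1 _ measurable0; rewrite indic0.
have pos g : bmeas g -> (forall x, 0 <= g x) -> V g.
  move=> [mg [M gM]] g0.
  have mg' : measurable_fun setT (EFin \o g) by exact/measurable_EFinP.
  have g0' x : setT x -> (0 <= (EFin \o g) x)%E by rewrite lee_fin.
  pose u n : T -> R := nnsfun_approx measurableT mg' n.
  have ug x : u ^~ x @ \oo --> g x.
    by have /fine_cvgP[_] := cvg_nnsfun_approx measurableT mg' g0' (x := x) I.
  apply: (bclosed_lim cV (u := u) (M := M)) => //.
  - move=> n.
    pose s := fset_set (range (u n)).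
    rewrite (_ : u n = fun x =>
        \sum_(i < #|`s|) (s`_i * \1_(u n @^-1` [set s`_i]) x)).
      apply: bclosed_sum => // i; apply: bclosedZ => //; apply: V1.
      by rewrite -[X in measurable X]setTI; exact: measurable_funP.
    by apply/funext => x; exact: fimfunEord.
  - move=> n x; rewrite ger0_norm; last exact: fun_ge0.
    rewrite (le_trans _ (le_trans (ler_norm _) (gM x)))//.
    rewrite -lee_fin /u nnsfun_approxE.
    exact: (le_approx (D := setT) (f := EFin \o g)).
move=> g bg; have [mg [M gM]] := bg.
(* As [M] bounds [|g|], the shifted function [g + M] is nonnegative; the shift is undone by a
   multiple of an indicator. *)
have -> : g = (fun x => (g x + M) + (- M) * \1_setT x).
  by apply/funext => x; rewrite indicT /=; lra.
apply: bclosedD => //.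
  apply: pos => [|x]; last by have := gM x; rewrite ler_norml; lra.
  exact: bmeasD bg (bmeas_cst M).
by apply: bclosedZ => //; exact: V1.
Qed.

(** An abstract stand-in for integration against a finite signed measure: linearity and dominated
    convergence, required on bounded measurable functions only. *)
Record bfunctional L := BFunctional {
  bfunctionalD : forall g h, bmeas g -> bmeas h ->
    L (fun x => g x + h x) = L g + L h ;
  bfunctionalZ : forall a g, bmeas g -> L (fun x => a * g x) = a * L g ;
  bfunctional_lim : forall (u : nat -> T -> R) g M,
    (forall n, bmeas (u n)) -> (forall n x, `|u n x| <= M) ->
    (forall x, u ^~ x @ \oo --> g x) -> L \o u @ \oo --> L g }.

Lemma bclosed_ker L : bfunctional L -> bclosed [set g | bmeas g /\ L g = 0].
Proof.
move=> fL; split.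
- by move=> g [].
- move=> g h [bg Lg] [bh Lh]; split; first exact: bmeasD.
  by rewrite bfunctionalD// Lg Lh addr0.
- move=> a g [bg Lg]; split; first exact: (bmeasM (bmeas_cst a)).
  by rewrite bfunctionalZ// Lg mulr0.
- move=> u g M uV uM ug; split.
    by apply: (bmeas_lim (u := u) (M := M)) => // n; case: (uV n) => -[].
  have Lu := bfunctional_lim fL (fun n => (uV n).1) uM ug.
  rewrite -(cvg_lim (@Rhausdorff R) Lu).
  rewrite (_ : L \o u = fun=> 0); first exact: lim_cst.
  by apply/funext => n /=; case: (uV n).
Qed.

Lemma bfunctionalB L L' : bfunctional L -> bfunctional L' ->
  bfunctional (fun g => L g - L' g).
Proof.
move=> fL fL'; split.
- by move=> g h bg bh; rewrite !bfunctionalD//; ring.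
- by move=> a g bg; rewrite !bfunctionalZ//; ring.
- move=> u g M bu uM ug.
  apply: (@cvgB _ R); [exact: (bfunctional_lim fL bu uM ug)|].
  exact: (bfunctional_lim fL' bu uM ug).
Qed.

Variable m : {measure set T -> \bar R}.

Lemma integrable_bmeas h g : m.-integrable setT (EFin \o h) -> bmeas g ->
  m.-integrable setT (EFin \o (fun x => h x * g x)).
Proof.
move=> ih [mg [M gM]].
have bg : [bounded g x | x in [set: T]].
  exists M; split; first by rewrite num_real.
  by move=> N MN x _ /=; rewrite (le_trans (gM x))// ltW.
exact: integrableMl ih mg bg.
Qed.

Lemma bfunctional_integral h : m.-integrable setT (EFin \o h) ->
  bfunctional (fun g => \int[m]_x (h x * g x)).
Proof.
move=> ih; split.
- move=> g1 g2 b1 b2; rewrite -RintegralD//; [|exact: integrable_bmeas..].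
  by apply: eq_Rintegral => x _; ring.
- move=> a g bg; rewrite -RintegralZl//; [|exact: integrable_bmeas].
  by apply: eq_Rintegral => x _; ring.
- move=> u g M bu uM ug.
  have bg : bmeas g.
    by apply: (bmeas_lim (u := u) (M := M)) => // n; case: (bu n).
  (* The dominating function for the products [h * u n]. *)
  have ihM : m.-integrable setT (EFin \o (fun x => `|h x| * M)).
    by apply: integrable_bmeas (bmeas_cst M); exact: integrable_abse ih.
  have [] := @dominated_convergence _ _ _ m _ measurableT
     (fun n x => (h x * u n x)%:E) (fun x => (h x * g x)%:E) _
     (fun n => measurable_int _ (integrable_bmeas ih (bu n)))
     (measurable_int _ (integrable_bmeas ih bg)) _ ihM.
  - apply: aeW => x _; apply: cvg_EFin; first by apply: nearW.
    by apply: cvgMr; exact: ug.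
  - apply: aeW => x n _ /=; rewrite lee_fin normrM ler_wpM2l//.
  - move=> igh _ cvgI; apply: fine_cvg.
    by rewrite fineK//; exact: integrable_fin_num.
Qed.

End bounded_measurable.

Lemma bfunctionalN d (T : measurableType d) (R : realType) (L : (T -> R) -> R) :
  bfunctional L -> bfunctional (fun g => - L g).
Proof.
move=> fL; split.
- by move=> g h bg bh; rewrite bfunctionalD// opprD.
- by move=> a g bg; rewrite bfunctionalZ// mulrN.
- by move=> u g M bu uM ug; apply: (@cvgN _ R); exact: bfunctional_lim ug.
Qed.

Lemma bfunctionalM d (T : measurableType d) (R : realType)
    (L : (T -> R) -> R) k :
  bfunctional L -> bmeas k -> bfunctional (fun g => L (fun x => k x * g x)).
Proof.
move=> fL bk; split.
- move=> g h bg bh; rewrite -bfunctionalD//; try exact: bmeasM.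
  by congr L; apply/funext => x; rewrite mulrDr.
- move=> a g bg; rewrite -bfunctionalZ//; last exact: bmeasM.
  by congr L; apply/funext => x; rewrite mulrCA.
- move=> u g M bu uM ug; have [_ [N kN]] := bk.
  apply: (bfunctional_lim fL (u := fun n x => k x * u n x) (M := N * M)).
  + by move=> n; exact: bmeasM.
  + by move=> n x; rewrite normrM ler_pM.
  + by move=> x; apply: cvgMr; exact: ug.
Qed.

Lemma bfunctional3 d (T : measurableType d) (R : realType) (L : (T -> R) -> R)
    a b c g h k :
  bfunctional L -> bmeas g -> bmeas h -> bmeas k ->
  L (fun x => a * g x + b * h x + c * k x) = a * L g + b * L h + c * L k.
Proof.
move=> fL bg bh bk; have bZ e f : bmeas f -> bmeas (fun x : T => e * f x : R).
  by move=> bf; exact: (bmeasM (bmeas_cst _ e)).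
by rewrite !bfunctionalD ?bfunctionalZ//; try apply: bmeasD; exact: bZ.
Qed.

Lemma bfunctional_comp d d' (T : measurableType d) (T' : measurableType d')
    (R : realType) (phi : T -> T') (L : (T -> R) -> R) :
  measurable_fun setT phi -> bfunctional L ->
  bfunctional (fun g : T' -> R => L (g \o phi)).
Proof.
move=> mphi fL.
have bphi (g : T' -> R) : bmeas g -> bmeas (g \o phi).
  move=> [mg [M gM]]; split; first exact: measurableT_comp.
  by exists M => x; exact: gM.
split.
- by move=> g h bg bh; rewrite -bfunctionalD//; exact: bphi.
- by move=> a g bg; rewrite -bfunctionalZ//; exact: bphi.
- move=> u g M bu uM ug.
  apply: (bfunctional_lim fL (u := fun n => u n \o phi) (M := M)) => //.
  + by move=> n; exact: bphi.
  + by move=> n x; exact: uM.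
  + by move=> x; exact: (ug (phi x)).
Qed.

(** * Uniqueness of the Fourier transform *)

Section bounded_algebra.
Context d (T : measurableType d) (R : realType).
Implicit Types (g : T -> R) (V : set (T -> R)).

Definition multiplier V : set (T -> R) :=
  [set u | bmeas u /\ forall g, V g -> V (fun x => u x * g x)].

Lemma bclosed_multiplier V : bclosed V -> bclosed (multiplier V).
Proof.
move=> cV; split.
- by move=> u [].
- move=> u v [bu Vu] [bv Vv]; split; first exact: bmeasD.
  move=> g Vg; under eq_fun do rewrite mulrDl.
  by apply: bclosedD => //; [exact: Vu|exact: Vv].
- move=> a u [bu Vu]; split; first exact: (bmeasM (bmeas_cst _ a)).
  move=> g Vg; under eq_fun do rewrite -mulrA.
  by apply: bclosedZ => //; exact: Vu.
- move=> u v M uV uM uv; split.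
    by apply: (bmeas_lim (u := u) (M := M)) => // n; case: (uV n) => -[].
  move=> g Vg; have [_ [N gN]] := bclosed_sub cV Vg.
  apply: (bclosed_lim cV (u := fun n x => u n x * g x) (M := M * N)).
  + by move=> n; exact: (uV n).2.
  + by move=> n x; rewrite normrM ler_pM.
  + by move=> x; apply: cvgMl; exact: uv.
Qed.

Lemma multiplierM V u v : multiplier V u -> multiplier V v ->
  multiplier V (fun x => u x * v x).
Proof.
move=> [bu Vu] [bv Vv]; split; first exact: bmeasM.
by move=> g Vg; under eq_fun do rewrite -mulrA; apply/Vu/Vv.
Qed.

Lemma multiplier_cst V (a : R) : bclosed V -> multiplier V (fun=> a).
Proof. by move=> cV; split; [exact: bmeas_cst|exact: bclosedZ]. Qed.

Variable V : set (T -> R).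
Hypothesis cV : bclosed V.
Local Notation A := (multiplier V).
Let cA : bclosed A := bclosed_multiplier cV.

(* The iterates of the odd polynomial t (3 - t^2) / 2 converge to the sign at
   every point of [-1, 1], including 0, so that no null set has to be discarded
   when passing to the limit. *)
Definition sg_step (t : R) := 2^-1 * (t * (3 + (- 1) * (t * t))).

Lemma sg_stepN t : sg_step (- t) = - sg_step t.
Proof. by rewrite /sg_step; ring. Qed.

Lemma iter_sg_stepN n t : iter n sg_step (- t) = - iter n sg_step t.
Proof. by elim: n => //= n ->; rewrite sg_stepN. Qed.

Lemma iter_sg_step0 n : iter n sg_step 0 = 0.
Proof. by elim: n => //= n ->; rewrite /sg_step mul0r mulr0. Qed.

(** One step multiplies the gap [1 - s] by [1 - s (1 + s) / 2]. The iterates never drop below [t],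
    so this factor is at most [1 - t / 2] and the gap decays geometrically. *)
Lemma iter_sg_step_bnd n (t : R) : 0 < t <= 1 ->
  t <= iter n sg_step t <= 1 /\ 1 - iter n sg_step t <= (1 - t / 2) ^+ n.
Proof.
move=> /andP[t0 t1]; elim: n => [|n [/andP[tu u1] un]].
  by rewrite /= lexx t1 expr0; split => //; lra.
rewrite iterS; set s := iter n sg_step t in tu u1 un *.
have e1 : 1 - sg_step s = (1 - s) * (1 - s * (1 + s) / 2).
  by rewrite /sg_step; field.
have e2 : sg_step s - s = s * (1 - s) * (1 + s) / 2.
  by rewrite /sg_step; field.
have f1 : 1 - s * (1 + s) / 2 <= 1 - t / 2 by nra.
have f2 : 0 <= 1 - s * (1 + s) / 2 by nra.
split.
  apply/andP; split; last by rewrite -subr_ge0 e1 mulr_ge0// subr_ge0.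
  rewrite (le_trans tu)// -subr_ge0 e2 !mulr_ge0//; lra.
by rewrite e1 exprSr ler_pM// subr_ge0.
Qed.

Lemma cvg_iter_sg_step (t : R) : `|t| <= 1 ->
  (fun n => iter n sg_step t) @ \oo --> Num.sg t.
Proof.
have pos (s : R) : 0 < s <= 1 -> (fun n => iter n sg_step s) @ \oo --> (1 : R).
  move=> s01; have /andP[s0 s1] := s01.
  have g0 : (fun n => (1 - s / 2) ^+ n) @ \oo --> (0 : R).
    by apply: cvg_expr; rewrite ger0_norm; lra.
  apply: (@squeeze_cvgr _ _ _ _ (fun n => 1 - (1 - s / 2) ^+ n) (fun=> 1)).
  - apply: nearW => n; have [/andP[_ ->] h] := iter_sg_step_bnd n s01.
    by rewrite andbT lerBlDr -lerBlDl.
  - by rewrite -[X in _ --> X]subr0; apply: cvgB; [exact: cvg_cst|exact: g0].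
  - exact: cvg_cst.
rewrite ler_norml => /andP[tN1 t1].
have [->|t0|t0] := sgrP t.
- rewrite (_ : (fun n => _) = fun=> 0); first exact: cvg_cst.
  by apply/funext => n; exact: iter_sg_step0.
- by apply: pos; rewrite t0.
- rewrite (_ : (fun n => _) = fun n => - iter n sg_step (- t)).
    by apply: cvgN; apply: pos; lra.
  by apply/funext => n; rewrite iter_sg_stepN opprK.
Qed.

(** The iterates of [sg_step] at [u] are polynomials in [u], hence multipliers, and they stay in
    [-1, 1]. *)
Lemma multiplier_sg u : A u -> (forall x, `|u x| <= 1) ->
  A (fun x => Num.sg (u x)).
Proof.
move=> Au u1.
apply: (bclosed_lim cA (u := fun n x => iter n sg_step (u x)) (M := 1)).
- elim => [|n IH] //=.
  apply: bclosedZ => //; apply: multiplierM => //.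
  apply: bclosedD => //; first exact: multiplier_cst.
  by apply: bclosedZ => //; exact: multiplierM.
- move=> n x; have := u1 x.
  have pos (s : R) : 0 < s <= 1 -> `|iter n sg_step s| <= 1.
    move=> s01; have [/andP[h1 h2] _] := iter_sg_step_bnd n s01.
    by rewrite ler_norml; lra.
  rewrite ler_norml => /andP[xN1 x1].
  have [x0|x0|x0] := ltgtP (u x) 0.
  + by rewrite -normrN -iter_sg_stepN; apply: pos; lra.
  + by apply: pos; rewrite x0.
  + by rewrite x0 iter_sg_step0 normr0.
- by move=> x; exact: cvg_iter_sg_step.
Qed.

(** Products of indicators give intersections and [1 - \1_B] gives complements, hence finite unions
    by De Morgan. The indicators of the partial unions are eventually constant at each point, which
    yields countable unions. *)
Lemma sigma_algebra_multiplier :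
  sigma_algebra setT [set B | measurable B /\ A \1_B].
Proof.
have A1 : A (fun=> 1) by exact: multiplier_cst.
have AsetC B : A \1_B -> A \1_(~` B).
  move=> AB; rewrite (_ : \1_(~` B) = fun x => 1 + (-1) * \1_B x :> R).
    by apply: bclosedD => //; exact: bclosedZ.
  by apply/funext => x; rewrite !indicE in_setC; case: (_ \in _) => /=; lra.
have AsetI B C : A \1_B -> A \1_C -> A \1_(B `&` C).
  by move=> AB AC; rewrite indicI; exact: multiplierM.
split => /=.
- by split => //; rewrite indic0; exact: multiplier_cst.
- by move=> B [mB AB]; rewrite setTD; split;
    [exact: measurableC|exact: AsetC].
- move=> B mAB.
  have mB n : measurable (B n) by case: (mAB n).
  split; first exact: bigcup_measurable.
  pose S n := \big[setU/set0]_(i < n) B i.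
  have AS n : A \1_(S n).
    rewrite /S; elim: n => [|n IH].
      by rewrite big_ord0 indic0; exact: multiplier_cst.
    rewrite big_ord_recr /= -[_ `|` B n]setCK setCU.
    by apply: (AsetC); apply: AsetI; apply: (AsetC) => //; case: (mAB n).
  apply: (bclosed_lim cA (u := fun n => \1_(S n)) (M := 1)) => //.
  + by move=> n x; rewrite indicE; case: (_ \in _); rewrite ?normr1 ?normr0.
  + move=> x; have [[k _ Bkx]|nB] := pselect ((\bigcup_k B k) x).
      apply: cvg_near_cst; exists k.+1 => // n /= kn.
      rewrite !indicE !mem_set//; first by exists k.
      by rewrite /S -bigcup_mkord; exists k.
    apply: cvg_near_cst; apply: nearW => n.
    rewrite !indicE !memNset// => -; rewrite /S -bigcup_mkord => -[k _ Bkx].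
    by apply: nB; exists k.
Qed.

End bounded_algebra.

(** * Functionals vanishing on trigonometric functions *)

Section trigonometric.
Variable R : realType.
Local Notation rR := (measurableTypeR R).

Lemma bmeas_cos (a b : R) : bmeas (fun x : rR => cos (a * x + b)).
Proof.
split; last by exists 1 => x; exact: cos_max.
apply: continuous_measurable_fun => x.
apply: continuous_comp; last exact: continuous_cos.
by apply: cvgD; [apply: cvgMr; exact: cvg_id|exact: cvg_cst].
Qed.

Lemma sg_sin (y : R) : `|y| < pi -> Num.sg (sin y) = Num.sg y.
Proof.
rewrite ltr_norml => /andP[yN y1].
have [->|y0|y0] := sgrP y; first by rewrite sin0 sgr0.
  by apply: gtr0_sg; apply: sin_gt0_pi; rewrite y0.
by apply: ltr0_sg; rewrite -oppr_gt0 -sinN; apply: sin_gt0_pi; lra.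
Qed.

(** The free phase [b] lets cosines alone cover the sines, and the family is stable under products
    up to linear combinations. *)
Lemma bfunctional_trig_eq0 (L : (rR -> R) -> R) : bfunctional L ->
  (forall a b, L (fun x => cos (a * x + b)) = 0) ->
  forall g, bmeas g -> L g = 0.
Proof.
move=> fL Lcos.
pose V : set (rR -> R) := [set g | bmeas g /\
  forall a b, L (fun x => cos (a * x + b) * g x) = 0].
have cV : bclosed V.
  split.
  - by move=> g [].
  - move=> g h [bg Vg] [bh Vh]; split; first exact: bmeasD.
    move=> a b; under eq_fun do rewrite mulrDr.
    by rewrite bfunctionalD ?Vg ?Vh ?addr0//; apply: bmeasM => //;
      exact: bmeas_cos.
  - move=> c g [bg Vg]; split; first exact: (bmeasM (bmeas_cst _ c)).
    move=> a b; under eq_fun do rewrite mulrCA.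
    by rewrite bfunctionalZ ?Vg ?mulr0//; apply: bmeasM => //; exact: bmeas_cos.
  - move=> u g M uV uM ug.
    split.
      by apply: (bmeas_lim (u := u) (M := M)) => // n; case: (uV n) => -[].
    move=> a b.
    have [_ _ _ h] := bclosed_ker fL.
    suff [] : [set g | bmeas g /\ L g = 0]
      (fun x => cos (a * x + b) * g x) by [].
    apply: (h (fun n x => cos (a * x + b) * u n x) _ M).
    + move=> n; have [bu Vu] := uV n.
      by split => //; apply: bmeasM => //; exact: bmeas_cos.
    + move=> n x; rewrite normrM -[M]mul1r ler_pM//; exact: cos_max.
    + by move=> x; apply: cvgMr; exact: ug.
have V1 : V (fun=> 1).
  split; first exact: bmeas_cst.
  by move=> a b; under eq_fun do rewrite mulr1.
pose A := multiplier V; have cA : bclosed A by exact: bclosed_multiplier.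
have Acos a b : A (fun x => cos (a * x + b)).
  split; first exact: bmeas_cos.
  move=> g [bg Vg]; split; first by apply: bmeasM => //; exact: bmeas_cos.
  move=> a' b'.
  (* The product-to-sum formula turns two cosine factors into cosines of the sum and the difference
     of the phases. *)
  rewrite (_ : (fun x => _) = fun x =>
    2^-1 * (cos ((a' + a) * x + (b' + b)) * g x +
            cos ((a' - a) * x + (b' - b)) * g x)).
    have bcg r s : bmeas (fun x : rR => cos (r * x + s) * g x).
      by apply: bmeasM => //; exact: bmeas_cos.
    by rewrite bfunctionalZ ?bfunctionalD ?Vg ?addr0 ?mulr0//; exact: bmeasD.
  apply/funext => x.
  have -> : (a' + a) * x + (b' + b) = (a' * x + b') + (a * x + b) by ring.
  have -> : (a' - a) * x + (b' - b) = (a' * x + b') - (a * x + b) by ring.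
  by move: (a' * x + b') (a * x + b) => p q; rewrite cosD cosB; field.
have Asg a : A (fun x => Num.sg (x - a)).
  apply: (bclosed_lim cA (u := fun n x => Num.sg (sin (n.+1%:R^-1 * (x - a))))
     (M := 1)).
  - move=> n; apply: (multiplier_sg cV) => [|x]; last exact: sin_max.
    under eq_fun do rewrite -cosBpihalf mulrBr -addrA.
    exact: Acos.
  - by move=> n x; rewrite normr_sg; case: (_ != 0).
  - move=> x; apply: cvg_near_cst; near=> n.
    rewrite sg_sin; first by rewrite sgrM gtr0_sg ?mul1r.
    rewrite normrM ger0_norm// mulrC ltr_pdivrMr// mulrC -ltr_pdivrMr ?pi_gt0//.
    (* From this rank on the scaled argument lies in (-pi, pi), where the sine has the sign of its
       argument. *)
    near: n; exists (Num.truncn (`|x - a| / pi)).+1 => //= n /= ?.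
    by rewrite (lt_trans (truncnS_gt _))// ltr_nat.
have Aray a : A \1_`]a, +oo[.
  (* For a sign [s], [(s + s^2) / 2] is 1 when [s = 1] and 0 when [s] is 0 or -1, so the endpoint
     [a] is left out, as the open ray demands. *)
  rewrite (_ : \1_ _ = fun x : rR => 2^-1 *
      (Num.sg (x - a) + Num.sg (x - a) * Num.sg (x - a))).
    apply: bclosedZ => //; apply: bclosedD => //.
    by apply: multiplierM; exact: Asg.
  apply/funext => x; rewrite indicE mem_setE in_itv/= andbT -subr_gt0.
  by have [_|_|_] := sgrP (x - a); rewrite ?ltxx/=; field.
have Aind B : measurable B -> A \1_B.
  have -> : measurable B = (@RGenOInfty.G R).-sigma.-measurable B.
    by rewrite -RGenOInfty.measurableE.
  move=> mB; suff [] : [set B | measurable B /\ A \1_B] B by [].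
  move: B mB; apply: smallest_sub; first exact: (sigma_algebra_multiplier cV).
  by move=> _ [a ->]; split => //; exact: measurable_itv.
(* Every bounded measurable [g] is now a multiplier; applied to the constant 1 in [V] and tested at
   frequency and phase 0, it gives [L g = 0]. *)
move=> g /(bclosed_bmeas cA Aind)[_] /(_ _ V1)[_] /(_ 0 0).
by under eq_fun do rewrite mul0r addr0 cos0 mulr1 mul1r.
Unshelve. all: by end_near. Qed.

End trigonometric.

(** * Measures on the cross *)

Section charge_integral.
Context d (T : measurableType d) (R : realType).
Variable nu : {charge set T -> \bar R}.

Lemma Rintegral_indic (m : {measure set T -> \bar R}) A : measurable A ->
  \int[m]_x \1_A x = fine (m A).
Proof. by move=> mA; rewrite /Rintegral integral_indic// setIT. Qed.

Lemma bfunctional_charge_integral : bfunctional (charge_integral nu).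
Proof.
have fin (m : {finite_measure set T -> \bar R}) :
    bfunctional (fun g => \int[m]_x g x).
  have i1 : m.-integrable setT (EFin \o (fun=> 1)).
    by apply: finite_measure_integrable_cst.
  rewrite (_ : (fun g => _) = (fun g => \int[m]_x ((fun=> 1) x * g x))).
    exact: bfunctional_integral.
  by apply/funext => g; apply: eq_Rintegral => x _; rewrite mul1r.
exact: (bfunctionalB (fin (jordan_pos (hahn_posneg nu)))
                     (fin (jordan_neg (hahn_posneg nu)))).
Qed.

Lemma charge_integral_indic A : measurable A ->
  charge_integral nu \1_A = fine (nu A).
Proof.
move=> mA; rewrite /charge_integral !Rintegral_indic//.
rewrite (jordan_decomp (hahn_posneg nu) mA) /cadd/= fineD//.
- by rewrite cscaleN1 fineN.
- exact: fin_num_measure.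
- by rewrite cscaleN1 fin_numN; exact: fin_num_measure.
Qed.

(** The difference of the two functionals has a kernel that is [bclosed] and contains the
    indicators. This trades the Jordan decomposition for any explicit formula that agrees on
    measurable sets. *)
Lemma charge_integral_eq L : bfunctional L ->
  (forall A, measurable A -> fine (nu A) = L \1_A) ->
  forall g, bmeas g -> charge_integral nu g = L g.
Proof.
move=> fL nuL g bg; apply/eqP; rewrite -subr_eq0; apply/eqP.
have fB := bfunctionalB bfunctional_charge_integral fL.
have [] // := bclosed_bmeas (bclosed_ker fB) _ bg.
move=> A mA; split; first exact: bmeas_indic.
by rewrite charge_integral_indic// nuL// subrr.
Qed.

End charge_integral.

(** Change of variables: [m'] is the image of [m] under [phi], and [p] undoes [phi], so [h \o p]
    pulls back to [h]. *)
Lemma Rintegral_pushforward_section d d' (R : realType)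
    (X : measurableType d) (Y : measurableType d')
    (m : {measure set X -> \bar R}) (m' : {measure set Y -> \bar R})
    (phi : X -> Y) (p : Y -> X) (h : X -> R) (A : set Y) :
  measurable_fun setT phi -> measurable_fun setT p -> cancel phi p ->
  (forall B, measurable B -> m' B = m (phi @^-1` B)) ->
  m.-integrable setT (EFin \o h) -> measurable A ->
  \int[m']_(y in A) h (p y) = \int[m]_x (h x * \1_A (phi x)).
Proof.
move=> mphi mp pK m'E ih mA.
have mA' : measurable (phi @^-1` A).
  by rewrite -[X in measurable X]setTI; exact: mphi.
rewrite /Rintegral; congr fine.
rewrite (@eq_measure_integral _ _ _ _ (pushforward m phi)); last first.
  by move=> B mB _; rewrite m'E.
rewrite integral_pushforward//.
- rewrite integral_mkcond; apply: eq_integral => x _.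
  rewrite /= patchE indicE.
  rewrite (_ : (x \in phi @^-1` A) = (phi x \in A)); last first.
    by apply/idP/idP => /set_mem Ax; exact: mem_set.
  by case: ifPn => _ /=; rewrite ?pK ?mulr1 ?mulr0.
- apply/measurable_EFinP; apply: measurableT_comp => //.
  by apply/measurable_EFinP; exact: measurable_int ih.
- rewrite (_ : _ \o phi = EFin \o h); first exact: integrableS ih.
  by apply/funext => x /=; rewrite pK.
Qed.

(** * Integration along the two axes and the Fourier transform *)

Section axes.
Variable R : realType.
Local Notation rR := (measurableTypeR R).
Local Notation plane := (rR * rR)%type.
Local Notation leb := (@lebesgue_measure R).
Local Notation delta0 := (dirac (0 : rR) : {measure set rR -> \bar R}).

Lemma measurable_xaxis : measurable_fun setT (fun x : rR => (x, 0 : rR)).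
Proof. by apply: measurable_fun_pair => //; exact: measurable_cst. Qed.

Lemma measurable_yaxis : measurable_fun setT (fun x : rR => (0 : rR, x)).
Proof. by apply: measurable_fun_pair => //; exact: measurable_cst. Qed.

Lemma leb_dirac0 (A : set plane) : measurable A ->
  (leb \x delta0)%E A = leb ((fun x => (x, 0)) @^-1` A).
Proof.
move=> mA; rewrite /product_measure1/=.
rewrite -[X in leb X]setIT -integral_indic//; last first.
  by rewrite -[X in measurable X]setTI; exact: measurable_xaxis.
apply: eq_integral => x _; rewrite diracE indicE; congr (_%:R%:E).
by apply: congr1; apply/idP/idP => /set_mem Ax; apply: mem_set; move: Ax;
  rewrite xsectionE.
Qed.

Lemma dirac0_leb (A : set plane) : measurable A ->
  (delta0 \x leb)%E A = leb ((fun x => (0, x)) @^-1` A).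
Proof.
move=> mA; rewrite /product_measure1/= integral_dirac//=.
  by rewrite diracT mul1e xsectionE.
exact: measurable_fun_xsection.
Qed.

(** Integration of [g] against the measure of the class with real density [h], pulled back to the
    real line. *)
Definition axis_integral (h : rR -> R) (g : plane -> R) : R :=
  \int[leb]_x (h x * g (x, 0)) - \int[leb]_x (h x * g (0, x)).

Lemma bfunctional_axis_integral h : leb.-integrable setT (EFin \o h) ->
  bfunctional (axis_integral h).
Proof.
move=> ih.
exact: (bfunctionalB
  (bfunctional_comp measurable_xaxis (bfunctional_integral ih))
  (bfunctional_comp measurable_yaxis (bfunctional_integral ih))).
Qed.

Lemma axis_integral_indic h A : leb.-integrable setT (EFin \o h) ->
  measurable A ->
  \int[(leb \x delta0)%E]_(z in A) h z.1 -
  \int[(delta0 \x leb)%E]_(z in A) h z.2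
  = axis_integral h \1_A.
Proof.
move=> ih mA; congr (_ - _).
  apply: (Rintegral_pushforward_section measurable_xaxis
    (@measurable_fst _ _ rR rR)) => //.
  exact: leb_dirac0.
apply: (Rintegral_pushforward_section measurable_yaxis
  (@measurable_snd _ _ rR rR)) => //.
exact: dirac0_leb.
Qed.

Lemma classC_axis_integral (mu : complex_measure plane R) : classC mu ->
  exists f1 f2 : rR -> R, [/\ leb.-integrable setT (EFin \o f1),
    leb.-integrable setT (EFin \o f2) & forall A, measurable A ->
    fine (cm_re mu A) = axis_integral f1 \1_A /\
    fine (cm_im mu A) = axis_integral f2 \1_A].
Proof.
move=> [f [if1 if2] muE].
exists (fun x => complex.Re (f x)), (fun x => complex.Im (f x)).
split => // A mA; rewrite -!axis_integral_indic//.
by have := muE A mA; rewrite /cm_val => -[-> ->].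
Qed.

Section fourier_line.
Variables (f1 f2 : rR -> R).
Hypothesis if1 : leb.-integrable setT (EFin \o f1).
Hypothesis if2 : leb.-integrable setT (EFin \o f2).

Lemma bmeas_phase (F : R -> R) (p : R * R) : continuous F ->
  (forall t, `|F t| <= 1) ->
  bmeas (fun z : plane => F (- (pi * (z.1 * p.1 + z.2 * p.2)))).
Proof.
move=> cF F1; split; last by exists 1.
apply: (@measurableT_comp _ _ _ _ _ _ F).
  exact: continuous_measurable_fun.
apply: measurableT_comp => //; apply: measurable_funM => //.
by apply: measurable_funD; apply: measurable_funM.
Qed.

(** The two equations are the real and the imaginary part of the integral of [cos + i sin] of the
    phase against [mu]. *)
Lemma fourier_axis_integral (mu : complex_measure plane R) (p : R * R) :
  (forall A, measurable A -> fine (cm_re mu A) = axis_integral f1 \1_A /\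
    fine (cm_im mu A) = axis_integral f2 \1_A) ->
  let phase (z : plane) := - (pi * (z.1 * p.1 + z.2 * p.2)) in
  fourier mu p = 0 ->
  axis_integral f1 (cos \o phase) = axis_integral f2 (sin \o phase) /\
  axis_integral f2 (cos \o phase) = - axis_integral f1 (sin \o phase).
Proof.
move=> muE phase.
have bc : bmeas (cos \o phase).
  by apply: bmeas_phase; [exact: continuous_cos|exact: cos_max].
have bs : bmeas (sin \o phase).
  by apply: bmeas_phase; [exact: continuous_sin|exact: sin_max].
have E1 := charge_integral_eq (bfunctional_axis_integral if1)
  (fun A mA => (muE A mA).1).
have E2 := charge_integral_eq (bfunctional_axis_integral if2)
  (fun A mA => (muE A mA).2).
rewrite /fourier /cm_integral /=.
have := (E1 _ bc, E1 _ bs, E2 _ bc, E2 _ bs).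
rewrite /comp /= => -[[[-> ->] ->] ->] [/eqP + /eqP +].
by rewrite subr_eq0 addr_eq0 => /eqP -> /eqP ->.
Qed.

End fourier_line.

End axes.

(** * Periodic Fourier transforms *)

Section increments.
Variable R : realType.
Local Notation rR := (measurableTypeR R).
Local Notation cosZ a := (fun x : rR => cos (a * x)).
Local Notation sinZ a := (fun x : rR => sin (a * x)).

Lemma bmeas_cosZ (a : R) : bmeas (cosZ a).
Proof. by have := bmeas_cos a 0; under eq_fun do rewrite addr0. Qed.

Lemma bmeas_sinZ (a : R) : bmeas (sinZ a).
Proof.
by have := bmeas_cos a (- (pi / 2)); under eq_fun do rewrite cosBpihalf.
Qed.

(** The versine, which is the real part of 1 - e^{-itx}; unlike the complex factor it is
    nonnegative. *)
Definition vers (t : R) (x : rR) : R := 1 - cos (t * x).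

Lemma bmeas_vers (t : R) : bmeas (vers t).
Proof.
rewrite /vers (_ : (fun x => _) = fun x : rR => 1 + (- 1) * cos (t * x)).
  apply: bmeasD; first exact: bmeas_cst.
  by apply: bmeasM; [exact: bmeas_cst|exact: bmeas_cosZ].
by apply/funext => x; ring.
Qed.

Section rotation.

(* With L1 and L2 integrating against the real and imaginary part of f, the
   hypotheses say that the Fourier transform of f has period t, and [rotate]
   that the real part of f(x) (1 - e^{-itx}) is orthogonal to the bounded
   functions; the imaginary part is the case of L2 and -L1. *)
Variables (L1 L2 : (rR -> R) -> R) (t : R).
Hypotheses (fL1 : bfunctional L1) (fL2 : bfunctional L2).
Hypothesis dcos1 : forall a,
  L1 (cosZ a) - L1 (cosZ (a + t)) = L2 (sinZ (a + t)) - L2 (sinZ a).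
Hypothesis dcos2 : forall a,
  L2 (cosZ a) - L2 (cosZ (a + t)) = L1 (sinZ a) - L1 (sinZ (a + t)).

Let cosZN a : cosZ (- a) = cosZ a.
Proof. by apply/funext => x; rewrite mulNr cosN. Qed.

Let sinZN (L : (rR -> R) -> R) a : bfunctional L ->
  L (sinZ (- a)) = - L (sinZ a).
Proof.
move=> fL; rewrite -[RHS]mulN1r -(bfunctionalZ fL _ (bmeas_sinZ a)).
by congr L; apply/funext => x; rewrite mulNr sinN mulN1r.
Qed.

Lemma rotate g : bmeas g ->
  L1 (fun x => vers t x * g x) = L2 (fun x => sin (t * x) * g x).
Proof.
move=> bg; apply/eqP; rewrite -subr_eq0; apply/eqP; move: g bg.
pose M g := L1 (fun x => vers t x * g x) - L2 (fun x => sin (t * x) * g x).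
have fM : bfunctional M.
  exact: bfunctionalB (bfunctionalM fL1 (bmeas_vers t))
                      (bfunctionalM fL2 (bmeas_sinZ t)).
apply: (bfunctional_trig_eq0 fM) => a b.
(* By parity, the relations at [- a] involve the frequency [a - t], which the product-to-sum
   formulas below produce next to [a + t]. *)
have := dcos1 a; have := dcos1 (- a); have := dcos2 a; have := dcos2 (- a).
have -> : - a + t = - (a - t) by ring.
rewrite !cosZN !sinZN// => e1 e2 e3 e4.
have bc := bmeas_cosZ; have bs := bmeas_sinZ.
have tE (x : rR) :
    ((a + t) * x = a * x + t * x) * ((a - t) * x = a * x - t * x).
  by split; ring.
have M1 : L1 (fun x => vers t x * cos (a * x)) =
    1 * L1 (cosZ a) + (- 2^-1) * L1 (cosZ (a + t))
    + (- 2^-1) * L1 (cosZ (a - t)).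
  rewrite -bfunctional3//; congr L1; apply/funext => x.
  by rewrite /vers !tE cosD cosB; field.
have M2 : L1 (fun x => vers t x * sin (a * x)) =
    1 * L1 (sinZ a) + (- 2^-1) * L1 (sinZ (a + t))
    + (- 2^-1) * L1 (sinZ (a - t)).
  rewrite -bfunctional3//; congr L1; apply/funext => x.
  by rewrite /vers !tE sinD sinB; field.
have M3 : L2 (fun x => sin (t * x) * cos (a * x)) =
    0 * L2 (sinZ a) + 2^-1 * L2 (sinZ (a + t)) + (- 2^-1) * L2 (sinZ (a - t)).
  rewrite -bfunctional3//; congr L2; apply/funext => x.
  by rewrite !tE sinD sinB; field.
have M4 : L2 (fun x => sin (t * x) * sin (a * x)) =
    0 * L2 (sinZ a) + (- 2^-1) * L2 (cosZ (a + t)) + 2^-1 * L2 (cosZ (a - t)).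
  rewrite -bfunctional3//; congr L2; apply/funext => x.
  by rewrite !tE cosD cosB; field.
have -> : (fun x : rR => cos (a * x + b)) =
    fun x => cos b * cosZ a x + - sin b * sinZ a x + 0 * sinZ a x.
  by apply/funext => x; rewrite cosD; ring.
rewrite bfunctional3// /M M1 M2 M3 M4.
(* The cosine coefficient vanishes by the half sum of [dcos1] at [a] and [- a], the sine coefficient
   by the half difference of [dcos2] at the same points. *)
rewrite [X in cos b * X](_ : _ = 0); last lra.
by rewrite [X in - sin b * X](_ : _ = 0); [rewrite !(mulr0, mul0r) !addr0|lra].
Qed.

End rotation.

(** Write v for [vers t x] and s for [sin (t * x)]. Rotating twice gives L1(v^2 g) = L2(s v g) = -
    L1(s^2 g), and v^2 + s^2 = 2 v. *)
Lemma vers_eq0 (L1 L2 : (rR -> R) -> R) (t : R) :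
  bfunctional L1 -> bfunctional L2 ->
  (forall a,
    L1 (cosZ a) - L1 (cosZ (a + t)) = L2 (sinZ (a + t)) - L2 (sinZ a)) ->
  (forall a,
    L2 (cosZ a) - L2 (cosZ (a + t)) = L1 (sinZ a) - L1 (sinZ (a + t))) ->
  forall g, bmeas g -> L1 (fun x => vers t x * g x) = 0.
Proof.
move=> fL1 fL2 d1 d2 g bg.
have bv := bmeas_vers t; have bs := bmeas_sinZ t.
have := rotate fL1 fL2 d1 d2 (bmeasM bv bg).
(* Replacing f by -i f turns the pair (L1, L2) into (L2, -L1) and preserves the hypotheses. *)
have := @rotate L2 (fun h => - L1 h) t fL2 (bfunctionalN fL1) _ _ _
  (bmeasM bs bg).
rewrite (_ : (fun x => sin (t * x) * (vers t x * g x)) =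
             (fun x => vers t x * (sin (t * x) * g x))); last first.
  by apply/funext => x; rewrite mulrCA.
move=> ->; [|by move=> a; rewrite d2; lra|by move=> a; have := d1 a; lra].
have bvv := bmeasM bv (bmeasM bv bg); have bss := bmeasM bs (bmeasM bs bg).
move=> /eqP; rewrite -addr_eq0 -(bfunctionalD fL1 bvv bss).
rewrite (_ : (fun x => _ + _) = (fun x => 2 * (vers t x * g x))).
  rewrite bfunctionalZ//; last exact: bmeasM.
  by rewrite mulf_eq0 pnatr_eq0 /= => /eqP.
apply/funext => x; rewrite /vers.
have := cos2Dsin2 (t * x); set c := cos _; set s := sin _ => cs.
rewrite !mulrA -mulrDl -expr2 -[s * s]expr2; congr (_ * _); nra.
Qed.

(** A point where the cosine is 1 is reduced modulo 2 pi to [r] in [0, 2 pi); injectivity of the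
    cosine on [0, pi], used for [r] or for [2 pi - r], forces [r = 0]. *)
Lemma countable_cos_eq1 (t : R) : t != 0 ->
  countable [set x : R | cos (t * x) = 1].
Proof.
move=> t0.
have key (y : R) : 0 <= y -> cos y = 1 -> exists k : nat, y = k%:R * (pi *+ 2).
  move=> y0 cy; have p0 := pi_gt0 R.
  have q0 : 0 < pi *+ 2 :> R by rewrite mulrn_wgt0.
  pose k := Num.truncn (y / (pi *+ 2)); exists k.
  have /andP[k1 k2] : k%:R <= y / (pi *+ 2) < k.+1%:R.
    by apply: truncn_itv; rewrite divr_ge0// ltW.
  rewrite ler_pdivlMr// in k1; rewrite ltr_pdivrMr// in k2.
  pose r := y - k%:R * (pi *+ 2).
  have cr : cos r = 1.
    rewrite -cy -[y](subrK (k%:R * (pi *+ 2))) -/r mulr_natl.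
    by rewrite (periodicn (@cosD2pi R)).
  have r0 : 0 <= r by rewrite subr_ge0.
  have r2 : r < pi *+ 2.
    by rewrite ltrBlDr (lt_le_trans k2)// -nat1r mulrDl mul1r.
  suff : r = 0 by move/eqP; rewrite subr_eq0 => /eqP.
  have [rp|pr] := leP r pi.
    by apply: cos_inj; rewrite ?cos0// in_itv/= ?lexx ?r0 ?rp// ltW.
  suff : pi *+ 2 - r = 0 by lra.
  apply: cos_inj; last by rewrite cos0 -cosN opprB -cosD2pi subrK.
    by rewrite in_itv/=; lra.
  by rewrite in_itv/= lexx ltW.
(* The boolean records the sign of [t * x]. *)
apply: (@sub_countable _ _ _ (range (fun k : nat * bool =>
   (-1) ^+ k.2 * (k.1%:R * (pi *+ 2)) / t))).
  apply: subset_card_le => x /= cx.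
  have [tx|tx] := leP 0 (t * x).
    have [k e] := key _ tx cx; exists (k, false) => //=.
    by rewrite expr0 mul1r -e mulrAC mulfV// mul1r.
  have tN : 0 <= - (t * x) by lra.
  have ctN : cos (- (t * x)) = 1 by rewrite cosN.
  have [k e] := key _ tN ctN; exists (k, true) => //=.
  by rewrite expr1 -e mulN1r opprK mulrAC mulfV// mul1r.
by apply: (sub_countable (card_image_le _ _)); exact: countableP.
Qed.

(** * Division by the versine *)

Local Notation leb := (@lebesgue_measure R).

(** Testing against the sign of [f] shows that [|f| * vers t] has integral 0, so [f] vanishes almost
    everywhere off the null set of zeros of the versine. *)
Lemma vers_integral_eq0 (f : rR -> R) (t : R) : t != 0 ->
  leb.-integrable setT (EFin \o f) ->
  (forall g, bmeas g -> \int[leb]_x (f x * (vers t x * g x)) = 0) ->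
  forall g, bmeas g -> \int[leb]_x (f x * g x) = 0.
Proof.
move=> t0 intf fv.
have mf : measurable_fun setT f.
  by apply/measurable_EFinP; exact: measurable_int intf.
have vers_ge0 x : 0 <= vers t x by rewrite subr_ge0 cos_le1.
have mA : measurable (f @^-1` `[0, +oo[).
  by rewrite -[X in measurable X]setTI; apply: mf => //; exact: measurable_itv.
pose P := f @^-1` `[0, +oo[.
(* A bounded measurable sign of [f], with value 1 where [f] is 0. *)
pose s : rR -> R := fun x => \1_P x + (-1) * \1_(~` P) x.
have fs x : f x * s x = `|f x|.
  rewrite /s !indicE in_setC.
  rewrite (_ : (x \in P) = (0 <= f x)); last first.
    apply/idP/idP => [/set_mem|fx]; first by rewrite /P /= in_itv/= andbT.
    by apply: mem_set; rewrite /P /= in_itv/= andbT.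
  by case: ger0P => _ /=; ring.
have bs : bmeas s.
  apply: bmeasD; first exact: bmeas_indic.
  by apply: bmeasM (bmeas_cst _ _) _; apply: bmeas_indic; exact: measurableC.
have bvs := bmeasM (bmeas_vers t) bs.
have fvsE x : (f x * (vers t x * s x))%:E = (`|(f x * vers t x)%:E|)%E.
  by rewrite /= normrM (ger0_norm (vers_ge0 x)) -fs; congr EFin; ring.
have int0 : (\int[leb]_x `|(f x * vers t x)%:E| = 0)%E.
  have := fv _ bs; rewrite /Rintegral; under eq_integral do rewrite fvsE.
  (* The hypothesis only gives 0 after [fine], which also sends infinite values to 0; finiteness of
     the integral excludes that. *)
  have := integrable_fin_num measurableT (integrable_bmeas intf bvs).
  rewrite /comp; under eq_integral do rewrite fvsE.
  by move=> /fineK {2}<- ->.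
have mfv : measurable_fun setT (fun x => (f x * vers t x)%:E).
  by apply: measurable_int; exact: integrable_bmeas intf (bmeas_vers t).
have /(ae_eq_integral_abs leb measurableT mfv) fv0 := int0.
have cos_ae : {ae leb, forall x, cos (t * x) <> 1}.
  exists [set x | cos (t * x) = 1]; split.
  - rewrite (_ : [set x | _] = cosZ t @^-1` [set 1])//.
    by rewrite -[X in measurable X]setTI; apply: (bmeas_cosZ t).1.
  - exact: (countable_lebesgue_measure0 (countable_cos_eq1 t0)).
  - by move=> x /= /contrapT.
move=> g bg; rewrite /Rintegral (ae_eq_integral (cst 0%E)) ?integral0//.
- by apply: measurable_int; exact: integrable_bmeas intf bg.
- apply: filterS2 fv0 cos_ae => x fvx cx _ /=.
  have [/eqP] := fvx I; rewrite mulf_eq0 => /orP[/eqP ->|].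
    by rewrite mul0r.
  by rewrite subr_eq0 => /eqP/esym/cx.
Qed.

End increments.

(** On the line, the transform is the difference of the transform of the density at two frequencies
    a fixed distance apart. Its vanishing is a period [t = pi * alpha], nonzero because [alpha]
    is. *)
Lemma classC_line_eq0 (R : realType) (alpha : R)
    (mu : complex_measure (measurableTypeR R * measurableTypeR R)%type R) :
  alpha != 0 -> classC mu -> (forall p, line alpha p -> fourier mu p = 0) ->
  forall A, measurable A -> mu A = 0.
Proof.
move=> alpha0 /classC_axis_integral[f1 [f2 [if1 if2 muE]]] mu0 A mA.
pose L (f : measurableTypeR R -> R) (g : measurableTypeR R -> R) :=
  \int[@lebesgue_measure R]_x (f x * g x).
have fL1 : bfunctional (L f1) := bfunctional_integral if1.
have fL2 : bfunctional (L f2) := bfunctional_integral if2.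
have pi0 : pi != 0 :> R by rewrite gt_eqF// pi_gt0.
(* The line is parametrised by [a / pi] to absorb the factor [pi] of the Fourier kernel: the
   frequencies are [a] on the first axis and [a + pi * alpha] on the second. *)
have ph1 (x a : R) : pi * (x * (a / pi) + 0 * (a / pi + alpha)) = a * x.
  by rewrite mul0r addr0 mulrCA [pi * _]mulrC divfK// mulrC.
have ph2 (x a : R) :
    pi * (0 * (a / pi) + x * (a / pi + alpha)) = (a + pi * alpha) * x.
  by rewrite mul0r add0r mulrCA mulrDr [pi * (_ / _)]mulrC divfK// mulrC.
have cE f a :
    axis_integral f
      (fun z => cos (- (pi * (z.1 * (a / pi) + z.2 * (a / pi + alpha))))) =
    L f (fun x => cos (a * x)) - L f (fun x => cos ((a + pi * alpha) * x)).
  by congr (_ - _); apply: eq_Rintegral => x _; rewrite /= cosN ?ph1 ?ph2.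
have sE f : bfunctional (L f) -> forall a,
    axis_integral f
      (fun z => sin (- (pi * (z.1 * (a / pi) + z.2 * (a / pi + alpha))))) =
    L f (fun x => sin ((a + pi * alpha) * x)) - L f (fun x => sin (a * x)).
  move=> fL a.
  have sN b : L f (fun x => -1 * sin (b * x)) = - L f (fun x => sin (b * x)).
    by rewrite bfunctionalZ ?mulN1r//; exact: bmeas_sinZ.
  transitivity (L f (fun x => -1 * sin (a * x))
      - L f (fun x => -1 * sin ((a + pi * alpha) * x))); last first.
    by rewrite !sN opprK addrC.
  by congr (_ - _); apply: eq_Rintegral => x _;
    rewrite /= sinN mulN1r ?ph1 ?ph2.
have E a :
    L f1 (fun x => cos (a * x)) - L f1 (fun x => cos ((a + pi * alpha) * x)) =
    L f2 (fun x => sin ((a + pi * alpha) * x)) - L f2 (fun x => sin (a * x)) /\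
    L f2 (fun x => cos (a * x)) - L f2 (fun x => cos ((a + pi * alpha) * x)) =
    L f1 (fun x => sin (a * x)) - L f1 (fun x => sin ((a + pi * alpha) * x)).
  have lp : line alpha (a / pi, a / pi + alpha).
    by rewrite /line /= addrAC subrr add0r.
  have := fourier_axis_integral if1 if2 muE (mu0 _ lp).
  by rewrite /comp /= !cE !sE// opprB.
have t0 : pi * alpha != 0 by rewrite mulf_neq0.
have z1 := vers_integral_eq0 t0 if1
  (vers_eq0 fL1 fL2 (fun a => (E a).1) (fun a => (E a).2)).
(* The imaginary part of the density is handled as the real part of -i f. *)
have z2 : forall g, bmeas g -> L f2 g = 0.
  apply: (vers_integral_eq0 t0 if2).
  apply: (vers_eq0 fL2 (bfunctionalN fL1)) => a.
    by rewrite (E a).2; lra.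
  by have := (E a).1; lra.
have bA (phi : measurableTypeR R -> measurableTypeR R * measurableTypeR R) :
    measurable_fun setT phi -> bmeas (\1_A \o phi : measurableTypeR R -> R).
  move=> mphi; have [mI [M IM]] := bmeas_indic R mA.
  by split; [exact: measurableT_comp|exists M => x; exact: IM].
have axis0 f : (forall g, bmeas g -> L f g = 0) -> axis_integral f \1_A = 0.
  move=> Lf0; rewrite -[RHS](subrr 0).
  congr (_ - _); first exact: (Lf0 _ (bA _ (@measurable_xaxis R))).
  exact: (Lf0 _ (bA _ (@measurable_yaxis R))).
by rewrite /cm_val (muE A mA).1 (muE A mA).2 !axis0.
Qed.

Theorem theorem2p1 (R : realType) (alpha1 alpha2 : R)
  (indep : rat_independent alpha1 alpha2) :
  is_HUP (@classC R) (line alpha1 `|` line alpha2).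
Proof.
have alpha0 : alpha1 != 0.
  apply/eqP => alpha0.
  (* If [alpha1] were 0, the coefficients 1 and 0 would form a nontrivial rational relation. *)
  have [] := indep 1 0; first by rewrite alpha0 mulr0 raddf0 mul0r addr0.
  by move/eqP; rewrite oner_eq0.
move=> mu Cmu mu0; apply: (classC_line_eq0 alpha0 Cmu) => p lp.
by apply: mu0; left.
Qed.
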